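(* Let $G$ be a Hausdorff locally compact, non-compact, non-discrete topological group. Then neither $G^{luc}$ nor $G^*=G^{luc}\setminus G$ is an F-space.
   Context: Let $G$ be a Hausdorff locally compact group and let $C_b(G)$ be the Banach space of bounded continuous functions on $G$ with the uniform norm. For $f\in C_b(G)$ and $g\in G$ let $l_gf(x)=f(gx)$. A function $f\in C_b(G)$ is called left uniformly continuous if the map $g\mapsto l_gf$ from $G$ to $C_b(G)$ is (norm-)continuous. $LUC(G)$ denotes the unital commutative $C^*$-algebra of all left uniformly continuous functions on $G$. The $luc$-compactification $G^{luc}$ is the Gelfand spectrum of $LUC(G)$, a compact Hausdorff space with $LUC(G)=C(G^{luc})$. The group $G$ is identified with its image in $G^{luc}$ under point evaluations, and $G^*:=G^{luc}\setminus G$ carries the subspace topology. A completely regular space $X$ is an F-space if for every continuous bounded (real-valued) function $f$ on $X$ there is a continuous bounded function $k$ on $X$ such that $f=k|f|$. *)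

(* Defs.v *)
From HB Require Import structures.
From mathcomp Require Import all_boot all_order all_algebra.
From mathcomp Require Import complex.
From mathcomp Require Import all_classical all_reals all_analysis.

Set Implicit Arguments.
Unset Strict Implicit.
Unset Printing Implicit Defensive.

Import Order.TTheory GRing.Theory Num.Theory.
Import numFieldNormedType.Exports.
Import ComplexField.Normc.

Local Open Scope classical_set_scope.
Local Open Scope ring_scope.
Local Open Scope complex_scope.

HB.instance Definition _ (R : rcfType) := NormedModule.copy R[i] R[i]^o.

HB.mixin Record isTopologicalGroup G & Topological G & Group G := {
  mulg_continuous : continuous (fun x : G * G => (x.1 * x.2)%g) ;
  invg_continuous : continuous (fun x : G => (x^-1)%g)
}.

#[short(type="topologicalGroupType")]
HB.structure Definition TopologicalGroup :=
  {G of Topological G & Group G & isTopologicalGroup G}.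

Section LeftUniformlyContinuous.
Variables (R : realType) (G : topologicalGroupType).
Implicit Types f : G -> R[i].

Definition left_translate (g : G) f : G -> R[i] := fun x => f (g * x)%g.

(* For unbounded [f] this is the junk value [sup A = 0]; it is only used on
   bounded functions. *)
Definition sup_norm f : R := sup (range (fun x => normc (f x))).

(* The norm of [C_b(G)] is [sup_norm], so the last clause is the continuity of
   [g |-> left_translate g f] at every point [g]. *)
Definition left_uniformly_continuous : set (G -> R[i]) :=
  [set f | [/\ continuous f, bounded_fun f &
    forall g : G, sup_norm (left_translate h f - left_translate g f)
      @[h --> g] --> (0 : R)]].

Definition luc_pred : {pred G -> R[i]} :=
  fun f => f \in left_uniformly_continuous.

Lemma normcE (z : R[i]) : `|z| = (normc z)%:C.
Proof. by case: z. Qed.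

Lemma normc_ge0 (z : R[i]) : 0 <= normc z.
Proof. by case: z => a b; rewrite sqrtr_ge0. Qed.

Lemma ler_normcD (z w : R[i]) : normc (z + w) <= normc z + normc w.
Proof. exact: (@le_normcD R z w). Qed.

Lemma ler_normcB (z w : R[i]) : normc (z - w) <= normc z + normc w.
Proof.
by apply: le_trans (ler_normcD _ _) _; rewrite lerD2l (normcN (w : Rcomplex R)).
Qed.

Lemma bounded_funE f :
  bounded_fun f <-> exists M : R, forall x, normc (f x) <= M.
Proof.
split=> [[M [Mreal fM]]|[M fM]].
  have := fM (M + 1); rewrite ltrDl ltr01 => /(_ isT) {}fM.
  exists (complex.Re (M + 1)) => x; have := fM x I.
  by rewrite /= normcE lecE /= => /andP[].
exists M%:C; split; first by rewrite complex_real.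
move=> N MN x _ /=; rewrite normcE; apply: le_trans (ltW MN).
by rewrite lecR.
Qed.

Lemma sup_norm_cvg0P f : bounded_fun f ->
  (forall g : G, sup_norm (left_translate h f - left_translate g f)
      @[h --> g] --> (0 : R)) <->
  (forall g e, 0 < e -> \forall h \near g,
      forall x, normc (f (h * x)%g - f (g * x)%g) <= e).
Proof.
move=> /bounded_funE[M fM].
have ubd h g : has_ubound
    (range (fun x => normc ((left_translate h f - left_translate g f) x))).
  exists (M + M) => _ [x _ <-].
  apply: (le_trans (ler_normcB (f (h * x)%g) (f (g * x)%g))).
  by rewrite lerD.
have sup0 h g : 0 <= sup_norm (left_translate h f - left_translate g f).
  apply: (le_trans (normc_ge0 (f (h * 1)%g - f (g * 1)%g))).
  by apply: (ub_le_sup (ubd h g)); exists 1%g.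
split=> H g.
  move=> e e0; have /cvgrPdist_le /(_ _ e0) := H g.
  apply: filterS => h; rewrite sub0r normrN ger0_norm // => he x.
  apply: le_trans he; apply: (ub_le_sup (ubd h g)).
  by exists x.
apply/cvgrPdist_le => e e0.
apply: filterS (H g e e0) => h he; rewrite sub0r normrN ger0_norm//.
apply: ge_sup; first by exists (normc ((left_translate h f - left_translate g f) 1%g)), 1%g.
by move=> _ [x _ <-]; exact: he.
Qed.

Lemma luc_predP f : reflect
  [/\ continuous f, exists M : R, forall x, normc (f x) <= M &
   forall g e, 0 < e -> \forall h \near g,
      forall x, normc (f (h * x)%g - f (g * x)%g) <= e]
  (f \in luc_pred).
Proof.
apply: (iffP idP).
  rewrite /luc_pred unfold_in inE => -[cf bf uf]; split=> //.
    exact/bounded_funE.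
  exact/sup_norm_cvg0P.
move=> [cf bf uf]; rewrite /luc_pred unfold_in inE; split=> //.
  exact/bounded_funE.
by apply/sup_norm_cvg0P => //; exact/bounded_funE.
Qed.

Lemma luc_submod_closed : submod_closed luc_pred.
Proof.
split=> [|a u v /luc_predP[cu [M uM] uu] /luc_predP[cv [N vN] uv]].
  apply/luc_predP; split=> [x|| g e e0]; first exact: cvg_cst.
    by exists 0 => x; rewrite normc0.
  by near=> h => x; rewrite subrr normc0 ltW.
apply/luc_predP; split=> [x||g e e0].
- apply: cvgD; last exact: cv.
  by apply: cvgZr; exact: cu.
- exists (normc a * M + N) => x.
  apply: le_trans (ler_normcD _ _) _; rewrite lerD//.
  by rewrite /= normcM ler_wpM2l ?normc_ge0.
- have a1 : 0 < normc a + 1 by rewrite ltr_wpDl ?normc_ge0.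
  near=> h => x.
  rewrite /= opprD addrACA.
  apply: le_trans (ler_normcD _ _) _.
  rewrite [leRHS]splitr lerD//.
    rewrite -scalerBr normcM.
    apply: (@le_trans _ _ ((normc a + 1) * (e / 2 / (normc a + 1)))).
      apply: ler_pM; rewrite ?normc_ge0// ?lerDl//.
      by move: x; near: h; apply: uu; rewrite !divr_gt0.
    by rewrite mulrC divfK ?gt_eqF.
  by move: x; near: h; apply: uv; rewrite divr_gt0.
Unshelve. all: by end_near. Qed.

Lemma luc_mulr_closed : mulr_closed luc_pred.
Proof.
split=> [|u v /luc_predP[cu [M uM] uu] /luc_predP[cv [N vN] uv]].
  apply/luc_predP; split=> [x|| g e e0]; first exact: cvg_cst.
    by exists 1 => x; rewrite normc1.
  by near=> h => x; rewrite subrr normc0 ltW.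
have M0 : 0 <= M by apply: le_trans (uM 1%g); exact: normc_ge0.
have N0 : 0 <= N by apply: le_trans (vN 1%g); exact: normc_ge0.
apply/luc_predP; split=> [x||g e e0].
- by apply: cvgM; [exact: cu|exact: cv].
- exists (M * N) => x.
  by rewrite normcM ler_pM ?normc_ge0.
- have M1 : 0 < M + 1 by rewrite ltr_wpDl.
  have N1 : 0 < N + 1 by rewrite ltr_wpDl.
  near=> h => x.
  rewrite -[X in normc X](_ : u (h * x)%g * (v (h * x)%g - v (g * x)%g) +
      (u (h * x)%g - u (g * x)%g) * v (g * x)%g = _); last first.
    by rewrite mulrBr mulrBl addrA subrK.
  apply: le_trans (ler_normcD _ _) _.
  rewrite [leRHS]splitr lerD// normcM.
    apply: (@le_trans _ _ ((M + 1) * (e / 2 / (M + 1)))).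
      apply: ler_pM; rewrite ?normc_ge0//.
        by apply: le_trans (uM _) _; rewrite lerDl.
      by move: x; near: h; apply: uv; rewrite !divr_gt0.
    by rewrite mulrC divfK ?gt_eqF.
  apply: (@le_trans _ _ ((e / 2 / (N + 1)) * (N + 1))).
    apply: ler_pM; rewrite ?normc_ge0//.
      by move: x; near: h; apply: uu; rewrite !divr_gt0.
    by apply: le_trans (vN _) _; rewrite lerDl.
  by rewrite divfK ?gt_eqF.
Unshelve. all: by end_near. Qed.

HB.instance Definition _ :=
  GRing.isSubmodClosed.Build R[i] (G -> R[i]) luc_pred luc_submod_closed.
HB.instance Definition _ :=
  GRing.isMulClosed.Build (G -> R[i]) luc_pred luc_mulr_closed.

Record LUC := MkLUC { LUC_fun :> G -> R[i] ; _ : LUC_fun \in luc_pred }.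
HB.instance Definition _ := [isSub for LUC_fun].
HB.instance Definition _ := [Choice of LUC by <:].
HB.instance Definition _ := [SubChoice_isSubZmodule of LUC by <:].
HB.instance Definition _ := [SubZmodule_isSubLmodule of LUC by <:].
HB.instance Definition _ :=
  GRing.SubZmodule_isSubPzRing.Build _ _ LUC (subringClosedP _).
HB.instance Definition _ := GRing.SubPzRing_isSubComPzRing.Build _ _ LUC.

(* The nonzero multiplicative linear functionals on [LUC(G)]; the pointwise
   topology of the ambient function space induces the weak-* (Gelfand)
   topology. *)
Definition gelfand_spectrum : set {ptws LUC -> R[i]} :=
  [set chi : LUC -> R[i] | [/\ scalar chi, {morph chi : u v / u * v} &
                 exists u, chi u != 0]].

Definition Gluc : uniformType := gelfand_spectrum.

Definition point_evaluation (g : G) : {ptws LUC -> R[i]} := fun u => u g.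

Lemma point_evaluation_subproof g : point_evaluation g \in gelfand_spectrum.
Proof.
by rewrite inE; split=> //; exists 1; rewrite /point_evaluation oner_neq0.
Qed.

Definition Gluc_of (g : G) : Gluc :=
  exist _ (point_evaluation g) (point_evaluation_subproof g).

Definition Gstar : uniformType := (~` range Gluc_of : set Gluc).

End LeftUniformlyContinuous.

(* Complete regularity is a standing requirement on [X], not a conjunct, so that
   [~ F_space R X] is not weakened; see [Gluc_completely_regular]
   and [Gstar_completely_regular]. *)
Definition F_space (R : realType) (X : topologicalType) : Prop :=
  forall f : X -> R, continuous f -> bounded_fun f ->
  exists k : X -> R, [/\ continuous k, bounded_fun k &
    forall x, f x = k x * `|f x|].

Lemma Gluc_completely_regular (R : realType) (G : topologicalGroupType) :
  completely_regular_space (Gluc R G).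
Proof. exact: (@uniform_completely_regular R). Qed.

Lemma Gstar_completely_regular (R : realType) (G : topologicalGroupType) :
  completely_regular_space (Gstar R G).
Proof. exact: (@uniform_completely_regular R). Qed.

Lemma Gluc_eval_continuous (R : realType) (G : topologicalGroupType) u :
  continuous (fun chi : Gluc R G => set_val chi u).
Proof.
move=> chi; apply: (@continuous_comp (Gluc R G) {ptws LUC R G -> R[i]} R[i]
  set_val (fun c => c u)).
  exact: (@initial_continuous (Gluc R G) {ptws LUC R G -> R[i]} set_val).
exact: (@proj_continuous (LUC R G) (fun=> R[i]) u).
Qed.

Lemma Gluc_hausdorff (R : realType) (G : topologicalGroupType) :
  hausdorff_space (Gluc R G).
Proof.
move=> p q pq; apply/val_inj/funext => u.
have hC : hausdorff_space R[i].
  exact: (@norm_hausdorff _ R[i]).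
apply: hC => A B Ap Bq.
have [c [Ac Bc]] := pq _ _
  (@Gluc_eval_continuous R G u p _ Ap) (@Gluc_eval_continuous R G u q _ Bq).
by exists (set_val c u).
Qed.

(* Main.v *)
Require Import Defs.
From mathcomp Require Import all_boot all_order all_algebra.
From mathcomp Require Import complex lra.
From mathcomp Require Import all_classical all_reals all_analysis.

(** Write G^luc for the spectrum and G^* for its remainder. The obstruction to
    being an F-space is a function on a small neighbourhood of 1 in G, and it
    is carried into G^* by one orbit.

    Obstruction. As G is Hausdorff and not discrete, the Birkhoff-Kakutani
    construction yields a continuous length function N on G that takes
    arbitrarily small positive values and whose small balls lie in a compact
    neighbourhood C of 1 (exists_group_seminorm). Choose a continuous phi on
    the reals which is positive at some values of N and negative at others,
    both arbitrarily close to 0 (exists_oscillating). The set K = {N = 0} is a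
    compact subgroup and N is right K-invariant. If a continuous h satisfies
    phi o N = h |phi o N| near 1, then h = 1 where phi o N > 0; points of that
    set with N -> 0 cluster at some z in K, and translating them by z^-1 keeps
    them in the set, so the set has 1 in its closure and h 1 = 1
    (seminorm_kernel_limit). Symmetrically h 1 = -1. The translation step is
    what handles a nonmetrizable G, where K is not trivial.

    Transport. As G is not compact there is a sequence t_n with
    N (t_i t_j^-1) >= r for i <> j (exists_separated_sequence). The function
    x |-> inf_i N (x t_i^-1) is in LUC(G), because the left translate by u
    moves it by at most N u, and its value at g t_n is N g for all n once N g
    is small (dist_to_separated_family). Along a free ultrafilter, the
    evaluations at g t_n converge to a character p g; the left uniform
    continuity of the elements of LUC(G) makes g |-> p g continuous
    (orbit_limit_continuous), and p g is in G^* because a right translate of a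
    small ball of N contains at most one t_n (orbit_limit_notin_range). So p
    maps G continuously into G^*, hence into both spaces, and pulls a
    continuous function D back to N near 1. A factorization of phi o D in
    either space gives, by composition with p, the forbidden h (not_F_space). *)

Set Implicit Arguments.
Unset Strict Implicit.
Unset Printing Implicit Defensive.

Import Order.TTheory GRing.Theory Num.Theory.
Import numFieldNormedType.Exports.
Import ComplexField.Normc.

Local Open Scope classical_set_scope.
Local Open Scope ring_scope.
Local Open Scope complex_scope.

(** * Preliminaries on the real line *)

Section Infimum.
Context {R : realType}.

Lemma inf_family_le (I : pointedType) (f : I -> R) i :
  (forall i, 0 <= f i) -> inf (range f) <= f i.
Proof.
move=> f0; apply: ge_inf; last by exists i.
by exists 0 => _ [j _ <-].
Qed.

Lemma inf_family_ge (I : pointedType) (f : I -> R) a :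
  (forall i, a <= f i) -> a <= inf (range f).
Proof.
move=> fa; apply: lb_le_inf; first by exists (f point), point.
by move=> _ [j _ <-].
Qed.

(** An infimum inherits every modulus of continuity common to the family. This
    gives both the left uniform continuity of the distance to a sequence in
    the group and the continuity of the distance to a subset of the line. *)
Lemma inf_family_dist (I : pointedType) (f g : I -> R) e :
  (forall i, 0 <= f i) -> (forall i, 0 <= g i) ->
  (forall i, `|f i - g i| <= e) -> `|inf (range f) - inf (range g)| <= e.
Proof.
move=> f0 g0 fg; rewrite ler_norml; apply/andP; split.
  suff : inf (range g) - e <= inf (range f) by lra.
  apply: inf_family_ge => i.
  by have := inf_family_le i g0; have := fg i; rewrite ler_norml; lra.
suff : inf (range f) - e <= inf (range g) by lra.
apply: inf_family_ge => i.
by have := inf_family_le i f0; have := fg i; rewrite ler_norml; lra.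
Qed.

Lemma inf_dist_continuous (I : pointedType) (c : I -> R) :
  continuous (fun x : R => inf (range (fun i => `|x - c i|))).
Proof.
move=> x; apply/cvgrPdist_le => e e0; near=> y.
apply: inf_family_dist => // i.
apply: le_trans (ler_dist_dist _ _) _.
rewrite opprB addrA subrK.
by near: y; apply: cvgr_dist_le => //; exact: cvg_id.
Unshelve. all: by end_near. Qed.

Lemma half_expr_lt (e : R) : 0 < e -> exists n, (2^-1 : R) ^+ n < e.
Proof.
move=> e0; have : (fun n => (2^-1 : R) ^+ n) @ \oo --> 0.
  by apply: cvg_expr; rewrite ger0_norm ?invr_ge0// invf_lt1// ltr1n.
move=> /cvgr0Pnorm_lt /(_ e e0)[n _ /(_ n (leqnn n)) /=].
by rewrite ger0_norm; [exists n|exact: exprn_ge0].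
Qed.

End Infimum.

(** * Continuous length functions on a topological group *)

Section Seminorm.
Context {R : realType} {G : topologicalGroupType}.

Definition group_seminorm (N : G -> R) : Prop :=
  [/\ N 1%g = 0, forall x, N x^-1%g = N x,
      forall x y, N (x * y)%g <= N x + N y & continuous N].

Lemma seminorm_ge0 N x : group_seminorm N -> 0 <= N x.
Proof.
move=> [N1 NV NM _]; have := NM x x^-1%g; rewrite mulgV N1 NV; lra.
Qed.

(** The bound does not depend on [y], the side on which LUC(G) asks for
    uniformity. *)
Lemma seminorm_dist N x y : group_seminorm N ->
  `|N (x * y)%g - N y| <= N x.
Proof.
move=> [N1 NV NM _]; rewrite ler_norml.
have := NM x y; have := NM x^-1%g (x * y)%g.
by rewrite mulKg NV; lra.
Qed.

Lemma mulgl_continuous (a : G) : continuous (fun x : G => (a * x)%g).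
Proof.
move=> x; apply: (@continuous_comp _ _ _ (fun x : G => (a, x))
  (fun z : G * G => (z.1 * z.2)%g)); last exact: mulg_continuous.
by apply: cvg_pair => //=; exact: cvg_cst.
Qed.

Lemma mulgr_continuous (a : G) : continuous (fun x : G => (x * a)%g).
Proof.
move=> x; apply: (@continuous_comp _ _ _ (fun x : G => (x, a))
  (fun z : G * G => (z.1 * z.2)%g)); last exact: mulg_continuous.
by apply: cvg_pair => //=; exact: cvg_cst.
Qed.

Lemma nbhs1_cube (V : set G) : nbhs 1%g V ->
  exists U : set G, [/\ nbhs 1%g U, forall x, U x -> U x^-1%g,
    forall x y z, U x -> U y -> U z -> V (x * y * z)%g & U `<=` V].
Proof.
have split (W : set G) : nbhs 1%g W -> exists U : set G,
    nbhs 1%g U /\ forall x y, U x -> U y -> W (x * y)%g.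
  move=> W1; have : nbhs ((1 : G), (1 : G))%g
      ((fun z : G * G => (z.1 * z.2)%g) @^-1` W).
    by apply: mulg_continuous => /=; rewrite mul1g.
  case=> -[A B] /= [A1 B1] AB; exists (A `&` B); split; first exact: filterI.
  by move=> x y [Ax _] [_ By]; exact: (AB (x, y)).
move=> /split[U [U1 UV]]; have [W [W1 WU]] := split U U1.
have Wi1 : nbhs 1%g ((fun x : G => x^-1%g) @^-1` W).
  by apply: invg_continuous => /=; rewrite invg1.
have WE x : W x -> U x.
  by move=> Wx; rewrite -[x]mulg1; apply: WU => //; exact: nbhs_singleton.
exists (W `&` (fun x : G => x^-1%g) @^-1` W); split.
- exact: filterI.
- by move=> x [Wx Wxi]; split => //=; rewrite invgK.
- by move=> x y z [Wx _] [Wy _] [Wz _]; apply: UV; [exact: WU|exact: WE].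
- move=> x [Wx _]; rewrite -[x]mulg1.
  by apply: UV; [exact: WE|exact: nbhs_singleton].
Qed.

End Seminorm.

(** Birkhoff-Kakutani: from neighbourhoods [V n] of 1 with the cube of [V n.+1]
    inside [V n], declare that an element of [V n] costs at most [2^-n] and
    take the cheapest way of writing [x] as a product of such elements. *)
Section ChainSeminorm.
Context {R : realType} {G : topologicalGroupType}.
Variable V : nat -> set G.
(* Taking [V 0] to be the whole group makes every element a product of length
   one, so that the infimum below is over a nonempty set. *)
Hypothesis V0 : V 0 = setT.
Hypothesis V1 : forall n, nbhs 1%g (V n).
Hypothesis VV : forall n x, V n x -> V n x^-1%g.
Hypothesis VM : forall n x y z,
  V n.+1 x -> V n.+1 y -> V n.+1 z -> V n (x * y * z)%g.

Let Vone n : V n 1%g. Proof. exact: nbhs_singleton. Qed.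

Let V_anti m n : (m <= n)%N -> V n `<=` V m.
Proof.
elim: n => [|n IHn]; first by rewrite leqn0 => /eqP->.
rewrite leq_eqVlt => /predU1P[->//|]; rewrite ltnS => /IHn VnVm x Vx.
by apply: VnVm; rewrite -[x]mulg1 -[(_ * _)%g]mulg1; exact: VM.
Qed.

Fixpoint chain_product (l : seq nat) : set G :=
  if l is n :: l' then
    [set (x * y)%g | x in V n & y in chain_product l'] else [set 1%g].

Definition chain_weight (l : seq nat) : R := \sum_(n <- l) 2^-1 ^+ n.

Let wcons n l : chain_weight (n :: l) = 2^-1 ^+ n + chain_weight l.
Proof. by rewrite /chain_weight big_cons. Qed.

Let wcat l1 l2 : chain_weight (l1 ++ l2) = chain_weight l1 + chain_weight l2.
Proof. by rewrite /chain_weight big_cat. Qed.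

Let w0 : chain_weight [::] = 0.
Proof. by rewrite /chain_weight big_nil. Qed.

Let w_ge0 l : 0 <= chain_weight l.
Proof. by apply: sumr_ge0 => n _; rewrite exprn_ge0. Qed.

Let half_gt0 n : (0 : R) < 2^-1 ^+ n. Proof. by rewrite exprn_gt0. Qed.

Lemma chain_product_cat l1 l2 x y :
  chain_product l1 x -> chain_product l2 y -> chain_product (l1 ++ l2) (x * y)%g.
Proof.
elim: l1 x => [|n l1 IH] x /= => [->|]; first by rewrite mul1g.
case=> a Va [b lb <-] ly; exists a => //; exists (b * y)%g; first exact: IH.
by rewrite mulgA.
Qed.

Lemma chain_product_cat_inv l1 l2 x : chain_product (l1 ++ l2) x ->
  exists y z, [/\ chain_product l1 y, chain_product l2 z & x = (y * z)%g].
Proof.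
elim: l1 x => [|n l1 IH] x /= => [lx|].
  by exists 1%g, x; rewrite mul1g.
case=> a Va [b /IH[y [z [ly lz ->]]] <-].
exists (a * y)%g, z; split => //; last by rewrite mulgA.
by exists a => //; exists y.
Qed.

Lemma chain_product_inv l x : chain_product l x -> chain_product (rev l) x^-1%g.
Proof.
elim: l x => [|n l IH] x /= => [->|]; first by rewrite invg1.
case=> a Va [b lb <-]; rewrite rev_cons -cats1 invgM.
apply: chain_product_cat; first exact: IH.
by exists a^-1%g; [exact: VV|exists 1%g => //; rewrite mulg1].
Qed.

(** Cut at the first factor after which less than [b] remains. Either it is the
    head, or at least [b] remains from it on, leaving less than [a] before. *)
Lemma chain_split l (a b : R) : l != [::] -> 0 < a -> 0 < b ->
  chain_weight l < a + b -> exists l1 m l2,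
  [/\ l = l1 ++ m :: l2, chain_weight l1 < a & chain_weight l2 < b].
Proof.
elim: l a => [//|m l IH] a _ a0 b0; rewrite wcons => wl.
have [wlb|bwl] := ltP (chain_weight l) b; first by exists [::], m, l; rewrite w0.
have lN : l != [::] by apply/eqP => l0; move: bwl; rewrite l0 w0; lra.
have [|||l1 [m' [l2 [-> w1 w2]]]] := IH (a - 2^-1 ^+ m) lN; try lra.
by exists (m :: l1), m', l2; split => //; rewrite wcons; lra.
Qed.

(** The heart of the construction, by induction on the number of factors. With
    total weight below [2^-n], cutting at half that weight leaves two shorter
    products of weight below [2^-(n+1)] around one factor of weight below
    [2^-n]; all three lie in [V n.+1], hence their product lies in [V n]. *)
Lemma chain_product_sub l n : chain_weight l < 2^-1 ^+ n ->
  chain_product l `<=` V n.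
Proof.
have [k] := ubnP (size l); elim: k l n => // k IH l n; rewrite ltnS => lk wl.
have [->|lN] := eqVneq l [::]; first by move=> _ /= ->; exact: Vone.
have wl2 : chain_weight l < 2^-1 ^+ n.+1 + 2^-1 ^+ n.+1.
  by rewrite exprS; lra.
have [l1 [m [l2 [El w1 w2]]]] :=
  chain_split lN (half_gt0 n.+1) (half_gt0 n.+1) wl2.
have sl : (size l1 + size l2 < k)%N.
  by move: lk; rewrite El size_cat /= addnS.
have mn : (n < m)%N.
  rewrite ltnNge; apply/negP => mn.
  have : (2^-1 : R) ^+ n <= 2^-1 ^+ m.
    by rewrite ler_wiXn2l // ?invr_ge0// invf_le1// ler1n.
  move: wl; rewrite El wcat wcons.
  by have := w_ge0 l1; have := w_ge0 l2; lra.
move=> x; rewrite El => /chain_product_cat_inv[y [z [l1y + ->]]].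
case=> a Va [b lb <-]; rewrite mulgA; apply: VM.
- by apply: (IH l1) => //; apply: leq_ltn_trans sl; exact: leq_addr.
- exact: V_anti Va.
- by apply: (IH l2) => //; apply: leq_ltn_trans sl; exact: leq_addl.
Qed.

Definition chain_seminorm (x : G) : R :=
  inf [set chain_weight l | l in [set l | chain_product l x]].

Lemma chain_seminorm_le l x :
  chain_product l x -> chain_seminorm x <= chain_weight l.
Proof.
move=> lx; apply: ge_inf; last by exists l.
by exists 0 => _ [j _ <-]; exact: w_ge0.
Qed.

Lemma chain_seminorm_adherent x e : 0 < e ->
  exists2 l, chain_product l x & chain_weight l < chain_seminorm x + e.
Proof.
move=> e0.
have [|_ [l lx <-] lw] := @inf_adherent _
    [set chain_weight l | l in [set l | chain_product l x]] e e0; last by exists l.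
split; last by exists 0 => _ [j _ <-]; exact: w_ge0.
exists (chain_weight [:: 0%N]), [:: 0%N] => //=.
by exists x; [rewrite V0|exists 1%g => //; rewrite mulg1].
Qed.

Lemma chain_seminorm_leV n x : V n x -> chain_seminorm x <= 2^-1 ^+ n.
Proof.
move=> Vx; have -> : 2^-1 ^+ n = chain_weight [:: n] by rewrite wcons w0 addr0.
by apply: chain_seminorm_le; exists x => //; exists 1%g => //; rewrite mulg1.
Qed.

Lemma chain_seminorm_ltV n x : chain_seminorm x < 2^-1 ^+ n -> V n x.
Proof.
move=> Nx; have e0 : 0 < 2^-1 ^+ n - chain_seminorm x by rewrite subr_gt0.
have [l lx lw] := chain_seminorm_adherent x e0.
by apply: chain_product_sub lx; lra.
Qed.

Lemma chain_seminormP : group_seminorm chain_seminorm.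
Proof.
have le0 (a b : R) : (forall e, 0 < e -> a <= b + e) -> a <= b.
  by move=> ab; apply/ler_addgt0Pr.
have Nge0 x : 0 <= chain_seminorm x.
  apply: le0 => e /(chain_seminorm_adherent x)[l _].
  by have := w_ge0 l; lra.
have NV x : chain_seminorm x^-1%g <= chain_seminorm x.
  apply: le0 => e /(chain_seminorm_adherent x)[l lx lw].
  have := chain_seminorm_le (chain_product_inv lx).
  have -> : chain_weight (rev l) = chain_weight l.
    by apply: perm_big; rewrite perm_rev.
  lra.
have NM x y : chain_seminorm (x * y)%g <= chain_seminorm x + chain_seminorm y.
  apply: le0 => e e0; have e2 : 0 < e / 2 by lra.
  have [l lx lw] := chain_seminorm_adherent x e2.
  have [l' ly lw'] := chain_seminorm_adherent y e2.
  have := chain_seminorm_le (chain_product_cat lx ly); rewrite wcat; lra.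
have N1 : chain_seminorm 1%g = 0.
  apply/eqP; rewrite eq_le Nge0 andbT -w0.
  exact: chain_seminorm_le.
have NVE x : chain_seminorm x^-1%g = chain_seminorm x.
  by apply/eqP; rewrite eq_le NV -{1}[x]invgK NV.
split => // x; apply/cvgrPdist_le => e e0.
have [n ne] := half_expr_lt e0.
have : nbhs x ((fun y : G => (y * x^-1)%g) @^-1` V n).
  by apply: mulgr_continuous; rewrite mulgV.
apply: filterS => y /= /chain_seminorm_leV Ny.
have H1 := NM (y * x^-1)%g x; have H2 := NM (y * x^-1)^-1%g y.
rewrite NVE in H2; rewrite mulgVK in H1.
rewrite invgM invgK mulgVK in H2.
rewrite ler_norml; lra.
Qed.

End ChainSeminorm.

(** The chain construction is applied to neighbourhoods of 1 that start inside
    [C] and each omit some point [x] of the preceding one. Such an [x] has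
    [N x] positive and at most a power of 1/2 that can be taken small: this
    gives the last clause, although {N = 0} may be infinite. *)
Lemma exists_group_seminorm (R : realType) (G : topologicalGroupType)
    (C : set G) :
  hausdorff_space G -> ~ (forall A : set G, open A) -> nbhs 1%g C ->
  exists N : G -> R, [/\ group_seminorm N, forall x, N x <= 1,
    forall x, N x < 2^-1 -> C x &
    forall e, 0 < e -> exists x, 0 < N x < e].
Proof.
move=> G_T2 G_ndisc C1.
have nontriv (U : set G) : nbhs 1%g U -> exists2 x, U x & x != 1%g.
  move=> U1; apply: contrapT => trivU; apply: G_ndisc => A.
  rewrite openE => x Ax; rewrite /interior.
  have : nbhs x ((fun y : G => (y * x^-1)%g) @^-1` U).
    by apply: mulgr_continuous; rewrite mulgV.
  apply: filterS => y /= Uyx.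
  have [/eqP|yx] := eqVneq (y * x^-1)%g 1%g; first by rewrite divg_eq1 => /eqP->.
  by case: trivU; exists (y * x^-1)%g.
have shrink (U : set G) : exists W : set G, nbhs 1%g U ->
    [/\ nbhs 1%g W, forall x, W x -> W x^-1%g,
     forall x y z, W x -> W y -> W z -> U (x * y * z)%g, W `<=` U &
     exists2 x, U x & ~ W x].
  have [U1|nU] := pselect (nbhs 1%g U); last by exists U.
  have [x Ux x1] := nontriv U U1.
  have [A [Aop A1 Ax]] : exists A : set G, [/\ open A, 1%g \in A & x \in ~` A].
    by apply: hausdorff_accessible => //; rewrite eq_sym.
  have [|W [W1 WV WM WA]] := @nbhs1_cube G (U `&` A).
    by apply: filterI => //; apply: open_nbhs_nbhs; split=> //; rewrite inE in A1.
  exists W => _; split => //.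
  - by move=> a b c Wa Wb Wc; have [] := WM a b c Wa Wb Wc.
  - by move=> a /WA[].
  - by exists x => // /WA[_ xA]; rewrite inE in Ax.
(* Outside the neighbourhoods of 1 the value of [F] is arbitrary. *)
have [F FP] := choice shrink.
have Fnbhs n : nbhs 1%g (iter n F C) by elim: n => //= n /FP[].
pose V n := if n is m.+1 then iter m.+1 F C else setT.
have V1 n : nbhs 1%g (V n) by case: n => [|n]; [exact: filterT|exact: Fnbhs].
have VV n x : V n x -> V n x^-1%g.
  by case: n => [//|n]; have [_ + _ _ _] := FP _ (Fnbhs n); exact.
have VM n x y z : V n.+1 x -> V n.+1 y -> V n.+1 z -> V n (x * y * z)%g.
  by case: n => [//|n]; have [_ _ + _ _] := FP _ (Fnbhs n.+1); exact.
exists (@chain_seminorm R G V); split.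
- exact: chain_seminormP.
- by move=> x; rewrite -[1](expr0 (2^-1)); exact: chain_seminorm_leV.
- move=> x Nx; have [_ _ _ + _] := FP _ C1; apply.
  by apply: (@chain_seminorm_ltV R G V _ V1 VM 1); rewrite ?expr1.
- move=> e e0.
  have [n ne] := half_expr_lt e0.
  have [_ _ _ _ [x Vx nVx]] := FP _ (Fnbhs n.+1).
  exists x; apply/andP; split.
    rewrite ltNge; apply/negP => Nx; apply: nVx.
    apply: (@chain_seminorm_ltV R G V _ V1 VM n.+2) => //.
    by apply: le_lt_trans Nx _; rewrite exprn_gt0.
  apply: le_lt_trans ne; apply: (@le_trans _ _ (2^-1 ^+ n.+1)).
    exact: chain_seminorm_leV.
  by rewrite ler_wiXn2l ?invr_ge0// invf_le1 ?ler1n// ltr0n.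
Qed.

(** * Functions that oscillate near 0, and separated sequences *)

(** Pick points of [S] with each at most half the preceding one, and subtract the
    distance to the even ones from the distance to the odd ones. Halving keeps
    a point [a n] at distance at least [a n / 2] from all the others, whence
    the strict signs; truncation gives boundedness. *)
Lemma exists_oscillating (R : realType) (S : set R) :
  (forall e, 0 < e -> exists2 s, S s & 0 < s < e) ->
  exists phi : R -> R, [/\ continuous phi, bounded_fun phi,
    forall e, 0 < e -> exists2 s, S s /\ 0 < s < e & 0 < phi s &
    forall e, 0 < e -> exists2 s, S s /\ 0 < s < e & phi s < 0].
Proof.
move=> S0.
have pick e : exists s, 0 < e -> S s /\ 0 < s < e.
  have [e0|ne] := pselect (0 < e); last by exists 0.
  by have [s Ss se] := S0 e e0; exists s.
have [F FP] := choice pick.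
pose a := fix a n := if n is n'.+1 then F (a n' / 2) else F 1.
have a_gt0 n : 0 < a n.
  elim: n => [|n IH] /=; first by have [_ /andP[]] := FP 1 ltr01.
  have a2 : 0 < a n / 2 by rewrite divr_gt0.
  by have [_ /andP[]] := FP _ a2.
have a2 n : 0 < a n / 2 by rewrite divr_gt0.
have Sa n : S (a n).
  by case: n => [|n]; [have [] := FP 1 ltr01|have [] := FP _ (a2 n)].
have aS n : a n.+1 <= a n / 2 by have [_ /andP[_ /ltW]] := FP _ (a2 n).
have a_anti m n : (m < n)%N -> a n <= a m / 2.
  elim: n => // n IH; rewrite ltnS leq_eqVlt => /predU1P[->//|/IH].
  by have := aS n; have := a_gt0 n; lra.
have a_sep m n : m != n -> a m / 2 <= `|a m - a n|.
  have := a_gt0 m; have := a_gt0 n.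
  by rewrite neq_ltn ler_normr => n0 m0 /orP[] /a_anti; lra.
have a_small e : 0 < e -> exists n, forall m, (n <= m)%N -> a m < e.
  move=> e0.
  have al n : a n <= a 0%N * 2^-1 ^+ n.
    by elim: n => [|n]; rewrite ?expr0 ?mulr1// exprS; have := aS n; lra.
  have [n ne] := half_expr_lt (divr_gt0 e0 (a_gt0 0%N)).
  exists n => m nm; apply: le_lt_trans (al m) _.
  rewrite mulrC -ltr_pdivlMr ?(a_gt0 0%N)//; apply: le_lt_trans ne.
  by rewrite ler_wiXn2l ?invr_ge0// invf_le1 ?ler1n// ltr0n.
pose d (c : nat -> R) x := inf (range (fun i => `|x - c i|)).
pose psi x := d (fun i => a i.*2.+1) x - d (fun i => a i.*2) x.
pose phi x := Num.min 1 (Num.max (-1) (psi x)).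
have dle c x i : d c x <= `|x - c i| by apply: inf_family_le.
exists phi; split.
- have psi_cont : continuous psi.
    by move=> x; apply: cvgB; exact: inf_dist_continuous.
  apply: (@min_fun_continuous _ R R (cst 1) (cst (-1) \max psi)).
    exact: cst_continuous.
  by apply: max_fun_continuous => //; exact: cst_continuous.
- exists 1; split; first by rewrite num_real.
  move=> M M1 x _; apply: le_trans (ltW M1).
  rewrite /= /phi ler_norml ge_min lexx /= le_min le_max lexx /=.
  by rewrite andbT; lra.
- move=> e /a_small[n nP]; exists (a n.*2).
    by split; rewrite // a_gt0 nP// -addnn leq_addr.
  rewrite /phi lt_min ltr01 lt_max; apply/orP; right.
  have := dle (fun i => a i.*2) (a n.*2) n; rewrite subrr normr0.
  have : a n.*2 / 2 <= d (fun i => a i.*2.+1) (a n.*2).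
    apply: inf_family_ge => i; apply: a_sep.
    by apply/eqP => /(congr1 odd) /=; rewrite !odd_double.
  by rewrite /psi; have := a_gt0 n.*2; lra.
- move=> e /a_small[n nP]; exists (a n.*2.+1).
    by split; rewrite // a_gt0 nP// -addnn leqW// leq_addr.
  rewrite /phi gt_min; apply/orP; right.
  rewrite gt_max; apply/andP; split; first lra.
  have := dle (fun i => a i.*2.+1) (a n.*2.+1) n; rewrite subrr normr0.
  have : a n.*2.+1 / 2 <= d (fun i => a i.*2) (a n.*2.+1).
    apply: inf_family_ge => i; apply: a_sep.
    by apply/eqP => /(congr1 odd) /=; rewrite !odd_double.
  by rewrite /psi; have := a_gt0 n.*2.+1; lra.
Qed.

(** Greedy choice: points with no admissible successor would cover the group by
    finitely many translates of [C]. *)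
Lemma exists_separated_sequence (R : realType) (G : topologicalGroupType)
    (N : G -> R) r (C : set G) :
  group_seminorm N -> compact C -> (forall x, N x < r -> C x) ->
  ~ compact [set: G] ->
  exists t : nat -> G, forall i j, i != j -> r <= N (t i * (t j)^-1)%g.
Proof.
move=> [N1 NV NM Ncont] Cc NC Gnc.
have next (s : seq G) : exists x, forall y, y \in s -> r <= N (x * y^-1)%g.
  apply: contrapT => H; apply: Gnc.
  have -> : [set: G] = \big[setU/set0]_(y <- s) ((fun x => (x * y)%g) @` C).
    rewrite predeqE => x; split => // _; apply: contrapT => Hx; apply: H.
    exists x => y ys; rewrite leNgt; apply/negP => /NC Cxy; apply: Hx.
    rewrite -bigcup_seq; exists y => //; exists (x * y^-1)%g => //.
    by rewrite mulgVK.
  apply: bigsetU_compact => y _; apply: continuous_compact => //.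
  by apply: continuous_subspaceT; exact: mulgr_continuous.
have [F FP] := choice next.
(* [p n] lists the first [n] points chosen, the latest first. *)
pose p := fix p n := if n is n'.+1 then F (p n') :: p n' else [::].
have pin i j : (i < j)%N -> F (p i) \in p j.
  elim: j => // j IH; rewrite ltnS leq_eqVlt /= inE => /predU1P[->|/IH ->].
    by rewrite eqxx.
  by rewrite orbT.
exists (fun n => F (p n)) => i j; rewrite neq_ltn => /orP[] ij.
  by rewrite -NV invgM invgK; apply: FP; exact: pin.
by apply: FP; exact: pin.
Qed.

(** * The obstruction at the identity *)

Lemma cluster_closed (T : topologicalType) (F : set_system T) (A : set T) p :
  cluster F p -> F A -> closed A -> A p.
Proof. by rewrite clusterE => Fp FA; apply; exact: Fp. Qed.

(** The points [y] with [N y -> 0] need not converge to 1, but they cluster at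
    some [p] with [N p = 0]. Since the hypothesis also covers the points
    [y * p^-1], which cluster at 1, continuity gives the value of [h] there. *)
Lemma seminorm_kernel_limit (R : realType) (G : topologicalGroupType)
    (N : G -> R) r (C : set G) (h : G -> R) c :
  group_seminorm N -> compact C -> 0 < r -> (forall x, N x < r -> C x) ->
  continuous h ->
  (forall e, 0 < e -> exists2 y, N y < e &
    forall z, N z = 0 -> h (y * z)%g = c) ->
  h 1%g = c.
Proof.
move=> Nsn Cc r0 NC hcont hc; have [N1 NV NM Ncont] := Nsn.
pose B e := [set y | N y < e /\ forall z, N z = 0 -> h (y * z)%g = c].
pose F := filter_from [set e | 0 < e] B.
have FF : ProperFilter F.
  apply: filter_from_proper; last by move=> e /= /hc[y Ny hy]; exists y.
  apply: filter_from_filter; first by exists 1 => /=.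
  move=> e1 e2 /= e10 e20; exists (Num.min e1 e2); rewrite /= ?lt_min ?e10//.
  by move=> y [] /=; rewrite lt_min => /andP[].
have FC : F C by exists r => // y [/NC].
have [p [Cp Fp]] := Cc F FF FC.
have Np : N p = 0.
  apply/eqP; rewrite eq_le seminorm_ge0// andbT; apply/ler_addgt0Pr.
  move=> e e0; rewrite add0r.
  apply: (@cluster_closed _ F [set x | N x <= e]) => //.
    by exists e => // y [/ltW].
  by apply: (@preimage_closed _ _ N [set x | x <= e]) => //; exact: closed_le.
have : [set x | h (x * p^-1)%g = c] p.
  apply: (@cluster_closed _ F) => //.
    by exists 1 => /= [|y [_]]; [exact: ltr01|apply; rewrite NV].
  apply: (@preimage_closed _ _ (fun x => h (x * p^-1)%g) [set x | x = c]); last first.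
    exact: closed_eq.
  move=> x _; apply: (@continuous_comp _ _ _ (fun x => (x * p^-1)%g) h).
    exact: mulgr_continuous.
  exact: hcont.
by rewrite /= mulgV.
Qed.

(** Along [p] a factorization of [phi o D] through its absolute value becomes one
    of [phi o N] near 1, and its factor would be both 1 and -1 at 1. *)
Lemma not_F_space (R : realType) (G : topologicalGroupType)
    (N : G -> R) r (C : set G) (X : topologicalType) (p : G -> X) (D : X -> R) :
  group_seminorm N -> compact C -> 0 < r -> (forall x, N x < r -> C x) ->
  (forall e, 0 < e -> exists x, 0 < N x < e) ->
  continuous p -> continuous D -> (forall g, N g < r -> D (p g) = N g) ->
  ~ F_space R X.
Proof.
move=> Nsn Cc r0 NC Nsmall pcont Dcont Dp FX; have [_ _ NM _] := Nsn.
have [|phi [phicont phib phi_pos phi_neg]] := @exists_oscillating R (range N).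
  by move=> e /Nsmall[x Nx]; exists (N x) => //; exists x.
have [||k [kcont _ kE]] := FX (phi \o D).
- by move=> x; apply: continuous_comp; [exact: Dcont|exact: phicont].
- by have [M [Mr MP]] := phib; exists M; split=> // m Mm x _; exact: (MP m Mm).
have kpcont : continuous (k \o p).
  by move=> x; apply: continuous_comp; [exact: pcont|exact: kcont].
have N0 y z : N z = 0 -> N (y * z)%g = N y.
  move=> Nz; have := NM y z; have := NM (y * z)%g z^-1%g.
  have [_ NV _ _] := Nsn; rewrite mulgK NV Nz; lra.
(* For a sign [c], the factor is [c] wherever [phi o N] has the sign [c]. *)
have value c : `|c| = 1 -> (forall e, 0 < e ->
    exists2 s, range N s /\ 0 < s < e & 0 < c * phi s) -> (k \o p) 1%g = c.
  move=> c1 cphi; apply: (seminorm_kernel_limit Nsn Cc r0 NC kpcont) => e e0.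
  have [|_ [[y _ <-] /andP[_]]] := cphi (Num.min e r); first by rewrite lt_min e0.
  rewrite lt_min => /andP[Nye Nyr] phiN; exists y => // z /(N0 y) Nyz.
  have := kE (p (y * z)%g); rewrite /= Dp Nyz //.
  have -> : `|phi (N y)| = c * phi (N y).
    by rewrite -[LHS]mul1r -c1 -normrM gtr0_norm.
  have phi0 : phi (N y) != 0.
    by apply: contraTneq phiN => ->; rewrite mulr0 ltxx.
  rewrite mulrA -{1}[phi _]mul1r => /(mulIf phi0) kc.
  have cc : c * c = 1 by rewrite -expr2 -real_normK ?num_real// c1 expr1n.
  by rewrite -[LHS]mulr1 -cc mulrA -kc mul1r.
have v1 : (k \o p) 1%g = 1.
  by apply: value; rewrite ?normr1 // => e /phi_pos[s]; exists s; rewrite ?mul1r.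
have : (k \o p) 1%g = -1.
  apply: value; rewrite ?normrN1 // => e /phi_neg[s sE s0].
  by exists s; rewrite ?mulN1r ?oppr_gt0.
rewrite v1; lra.
Qed.

(** * Limits of bounded complex functions along ultrafilters *)

Section Complex.
Context {R : realType}.

Lemma normc_real (a : R) : normc a%:C = `|a|.
Proof. by rewrite /normc /= expr0n addr0 sqrtr_sqr. Qed.

Lemma ler_norm_Re (z : R[i]) : `|complex.Re z| <= normc z.
Proof.
case: z => a b; rewrite /normc /= -sqrtr_sqr ler_wsqrtr// lerDl.
exact: sqr_ge0.
Qed.

Lemma ler_norm_Im (z : R[i]) : `|complex.Im z| <= normc z.
Proof.
case: z => a b; rewrite /normc /= -sqrtr_sqr ler_wsqrtr// lerDr.
exact: sqr_ge0.
Qed.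

Lemma cvg_normcP (T : Type) (F : set_system T) {FF : Filter F} (f : T -> R[i]) l :
  f @ F --> l <->
  forall e : R, 0 < e -> \forall x \near F, normc (l - f x) <= e.
Proof.
split=> [fl e e0|fl].
  have eC : (0 : R[i]) < e%:C by rewrite ltcR.
  move/cvgrPdist_le: fl => /(_ _ eC); apply: filterS => x.
  by rewrite Defs.normcE lecR.
apply/cvgrPdist_le => -[e e']; rewrite ltcE /= => /andP[/eqP-> e0].
by apply: filterS (fl e e0) => x; rewrite Defs.normcE lecR.
Qed.

Lemma Re_continuous : continuous (fun z : R[i] => complex.Re z).
Proof.
move=> z; have zF : Filter (nbhs z) by exact: (@nbhs_filter R[i] z).
apply/cvgrPdist_le => e e0.
have := iffLR (cvg_normcP (FF := zF) (fun w => w) z) (@cvg_id _ (nbhs z)) e e0.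
apply: filterS => w; apply: le_trans; apply: le_trans (ler_norm_Re _).
by move: {zF} z w => [a b] [c d].
Qed.

Lemma Complex_continuous :
  continuous (fun z : R * R => (z.1 +i* z.2)%C : R[i]).
Proof.
move=> [a b]; apply/cvg_normcP => e e0.
have e2 : 0 < e / 2 by rewrite divr_gt0.
have /cvgrPdist_le/(_ _ e2) A1 : (fun z : R * R => z.1) @ (a, b) --> a.
  by exact: cvg_fst.
have /cvgrPdist_le/(_ _ e2) A2 : (fun z : R * R => z.2) @ (a, b) --> b.
  by exact: cvg_snd.
apply: filterS (filterI A1 A2) => -[c d] /= [ac bd].
suff : normc ((a - c)%:C + (0 +i* (b - d))%C) <= e.
  by rewrite /normc /= addr0 add0r.
apply: le_trans (ler_normcD _ _) _; rewrite normc_real.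
have -> : normc (0 +i* (b - d))%C = `|b - d|.
  by rewrite /normc /= expr0n add0r sqrtr_sqr.
by rewrite [e]splitr; apply: lerD.
Qed.

End Complex.

Lemma ultra_compact_cvg (I : Type) (U : set_system I) (T : topologicalType)
    (K : set T) (f : I -> T) :
  UltraFilter U -> compact K -> (forall i, K (f i)) ->
  exists l : T, f @ U --> l.
Proof.
move=> UU Kc Kf.
have [|l [_ fl]] := Kc (f @ U) _; first by apply: (@filterE _ U).
exists l => A lA; have [//|UnA] := in_ultra_setVsetC (f @^-1` A) UU.
by have [x []] := fl _ _ (UnA : (f @ U) (~` A)) lA.
Qed.

Lemma ultra_bounded_cvg (R : realType) (I : Type) (U : set_system I)
    (f : I -> R[i]) (M : R) :
  UltraFilter U -> (forall i, normc (f i) <= M) -> exists l : R[i], f @ U --> l.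
Proof.
move=> UU fM.
apply: (@ultra_compact_cvg _ _ _
  ((fun z : R * R => (z.1 +i* z.2)%C : R[i]) @` (`[- M, M] `*` `[- M, M]))) => //.
  apply: continuous_compact.
    by apply: continuous_subspaceT; exact: Complex_continuous.
  by apply: compact_setX; exact: segment_compact.
move=> i; exists (complex.Re (f i), complex.Im (f i)); last by case: (f i).
by split; rewrite /= in_itv /= -ler_norml;
  [apply: le_trans (ler_norm_Re _) _|apply: le_trans (ler_norm_Im _) _].
Qed.

(** * Elements of LUC(G) built from a length function *)

Section LUC_of_seminorm.
Context {R : realType} {G : topologicalGroupType}.

Lemma real_luc (D : G -> R) (M : R) : (forall x, `|D x| <= M) ->
  (forall g e, 0 < e -> \forall h \near g,
    forall x, `|D (h * x)%g - D (g * x)%g| <= e) ->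
  (fun x => (D x)%:C) \in @luc_pred R G.
Proof.
move=> DM Du; apply/luc_predP; split.
- move=> g; apply/cvg_normcP => e e0; apply: filterS (Du g e e0) => h /(_ 1%g).
  by rewrite !mulg1 -rmorphB normc_real distrC.
- by exists M => x; rewrite normc_real.
- move=> g e e0; apply: filterS (Du g e e0) => h hD x.
  by rewrite -rmorphB normc_real.
Qed.

Variable N : G -> R.
Hypothesis Nsn : group_seminorm N.
Hypothesis N_le1 : forall x, N x <= 1.

(** Two instances matter: [a = 1] with a separated sequence gives the function
    that detects [N] at infinity, and a one-point family gives the functions
    that separate a limit character from the points of the group. *)
Definition dist_to_family (I : pointedType) (a : G) (t : I -> G) (x : G) : R :=
  inf (range (fun i => N (a * x * (t i)^-1)%g)).

Lemma dist_to_family_luc (I : pointedType) a (t : I -> G) :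
  (fun x => (dist_to_family a t x)%:C) \in @luc_pred R G.
Proof.
have N0 x := seminorm_ge0 x Nsn.
apply: (@real_luc _ 1) => [x|g e e0].
  rewrite ger0_norm; last exact: inf_family_ge.
  exact: le_trans (inf_family_le point _) _.
have : (fun h => N (a * h * (g^-1 * a^-1))%g) @ g --> (0 : R).
  have <- : N (a * g * (g^-1 * a^-1))%g = 0.
    by rewrite mulgA mulgK mulgV; case: Nsn.
  have [_ _ _ Ncont] := Nsn.
  have mcont : continuous (fun h => (a * h * (g^-1 * a^-1))%g).
    move=> h; apply: (@continuous_comp _ _ _ (fun h => (a * h)%g)
      (fun h => (h * (g^-1 * a^-1))%g)).
      exact: mulgl_continuous.
    exact: mulgr_continuous.
  exact: (@continuous_comp _ _ _ _ N g (mcont g) (Ncont _)).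
move=> /cvgr0Pnorm_le/(_ e e0); apply: filterS => h; rewrite ger0_norm // => he x.
apply: inf_family_dist => // i; apply: le_trans he.
rewrite -(_ : a * h * (g^-1 * a^-1) * (a * (g * x) * (t i)^-1) =
  a * (h * x) * (t i)^-1)%g.
  exact: seminorm_dist.
by rewrite !mulgA mulgVK (mulgVK g).
Qed.

Definition dist_to_family_LUC (I : pointedType) a (t : I -> G) : LUC R G :=
  MkLUC (dist_to_family_luc a t).

End LUC_of_seminorm.

(** * The orbit of a limit character *)

Lemma ptws_continuous (X : topologicalType) (U : choiceType) (V : uniformType)
    (h : X -> {ptws U -> V}) :
  (forall u, continuous (fun x => h x u)) -> continuous h.
Proof.
move=> hu x; apply/cvg_sup => u.
exact: (@continuous_comp_initial _ X V (fun f : U -> V => f u) h (hu u) x).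
Qed.

(** The limit of the evaluations at [g * t n] along an ultrafilter is the product
    of [g] with the limit character of [t]. *)
Section OrbitLimit.
Context {R : realType} {G : topologicalGroupType}.
Variables (U : set_system nat) (UU : UltraFilter U) (t : nat -> G).

Lemma LUC_ultra_cvg (u : LUC R G) g :
  exists l : R[i], u (g * t n)%g @[n --> U] --> l.
Proof.
case: u => u /= /luc_predP[_ [M uM] _].
by apply: (@ultra_bounded_cvg _ _ _ _ M) => // n; exact: uM.
Qed.

Definition orbit_limit_fun (g : G) : {ptws LUC R G -> R[i]} :=
  fun u => lim (u (g * t n)%g @[n --> U]).

Lemma orbit_limit_cvg g (u : LUC R G) :
  u (g * t n)%g @[n --> U] --> orbit_limit_fun g u.
Proof.
have [l ul] := LUC_ultra_cvg u g.
by rewrite /orbit_limit_fun (cvg_lim _ ul)//; exact: norm_hausdorff.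
Qed.

Lemma orbit_limitE g (u : LUC R G) l :
  u (g * t n)%g @[n --> U] --> l -> orbit_limit_fun g u = l.
Proof. by move=> ul; apply: cvg_lim ul; exact: norm_hausdorff. Qed.

Lemma orbit_limit_spectrum g : orbit_limit_fun g \in @gelfand_spectrum R G.
Proof.
rewrite inE; split.
- move=> a u v; apply: orbit_limitE.
  apply: cvgD; last exact: orbit_limit_cvg.
  by apply: cvgZr; exact: orbit_limit_cvg.
- move=> u v; apply: orbit_limitE.
  by apply: cvgM; exact: orbit_limit_cvg.
- exists 1; rewrite (@orbit_limitE g 1 1) ?oner_neq0//.
  exact: cvg_cst.
Qed.

Definition orbit_limit (g : G) : Gluc R G :=
  exist _ (orbit_limit_fun g) (orbit_limit_spectrum g).

(** For [h] near [g], the values of [u] at [h * t n] and [g * t n] are close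
    uniformly in [n], which survives in the limit. *)
Lemma orbit_limit_continuous : continuous orbit_limit.
Proof.
apply: continuous_comp_initial; apply: ptws_continuous => u g.
apply/cvg_normcP => e e0.
have [_ _ uu] := elimT (luc_predP _) (valP u).
apply: filterS (uu g e e0) => h hu.
have : u (g * t n)%g - u (h * t n)%g @[n --> U] -->
    orbit_limit_fun g u - orbit_limit_fun h u.
  by apply: cvgB; exact: orbit_limit_cvg.
move=> /cvg_normcP ul; apply/ler_addgt0Pr => d d0.
have [n un] := filter_ex (ul d d0).
rewrite -[X in normc X](subrK (u (g * t n)%g - u (h * t n)%g)) addrC.
apply: le_trans (ler_normcD _ _) _; rewrite lerD//.
by rewrite -normcN opprB; exact: hu.
Qed.

(** If the limit were the evaluation at [b], put [c = g^-1 b] and test on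
    [u x = N (g^-1 x c^-1)]. It vanishes at [b], while its value
    [N (t n c^-1)] at [g * t n] is below [r / 2] for at most one [n]. *)
Lemma orbit_limit_notin_range (N : G -> R) r : \oo `<=` U ->
  group_seminorm N -> (forall x, N x <= 1) -> 0 < r ->
  (forall i j, i != j -> r <= N (t i * (t j)^-1)%g) ->
  forall g, (~` range (@Gluc_of R G)) (orbit_limit g).
Proof.
move=> Uoo Nsn N1 r0 tN g [b _ /(congr1 val) Eb].
pose c := (g^-1 * b)%g.
pose u := dist_to_family_LUC Nsn N1 g^-1%g (fun _ : unit => c).
have uE x : u x = (N (g^-1 * x * c^-1)%g)%:C.
  rewrite /u /= /dist_to_family; congr (_ %:C).
  by rewrite (_ : range _ = [set N (g^-1 * x * c^-1)%g]) ?inf1// predeqE => y;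
    split=> [[_ _ <-]|->] //; exists tt.
have ub : orbit_limit_fun g u = 0.
  have <- : u b = orbit_limit_fun g u := congr1 (fun chi => chi u) Eb.
  by rewrite uE mulgV; have [-> _ _ _] := Nsn.
have r2 : 0 < r / 2 by rewrite divr_gt0.
have far : \forall n \near U, r / 2 <= N (t n * c^-1)%g.
  apply: Uoo.
  have [[m Nm]|H] := pselect (exists m, N (t m * c^-1)%g < r / 2); last first.
    exists 0%N => // n _ /=; rewrite leNgt; apply/negP => Nn.
    by apply: H; exists n.
  exists m.+1 => // n /= mn.
  have nm : n != m by rewrite gtn_eqF.
  have [_ NV NM _] := Nsn.
  have := NM (t n * c^-1)%g (t m * c^-1)^-1%g.
  by rewrite NV mulgKA; have := tN _ _ nm; lra.
have r4 : 0 < r / 4 by rewrite divr_gt0.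
have near0 := iffLR (cvg_normcP _ _) (@orbit_limit_cvg g u) _ r4.
have [n [nfar]] := filter_ex (filterI far (near0 _)).
rewrite ub uE sub0r normcN normc_real mulKg ger0_norm ?seminorm_ge0//.
by move: nfar; lra.
Qed.

End OrbitLimit.

(** The index [j] contributes [N g]; any other [i] contributes at least
    [r - N g], which is larger. *)
Lemma dist_to_separated_family (R : realType) (G : topologicalGroupType)
    (N : G -> R) r (t : nat -> G) g j :
  group_seminorm N -> (forall i j, i != j -> r <= N (t i * (t j)^-1)%g) ->
  N g < r / 2 -> dist_to_family N 1%g t (g * t j)%g = N g.
Proof.
move=> Nsn tN Ng; have [_ NV NM _] := Nsn.
apply/eqP; rewrite eq_le; apply/andP; split.
  have -> : N g = N (1 * (g * t j) * (t j)^-1)%g by rewrite mul1g mulgK.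
  by apply: (inf_family_le j) => i; exact: seminorm_ge0.
apply: inf_family_ge => i; rewrite mul1g.
have [->|ij] := eqVneq i j; first by rewrite mulgK.
have := NM g^-1%g (g * t j * (t i)^-1)%g.
rewrite -mulgA mulKg NV; have := tN j i; rewrite eq_sym => /(_ ij).
lra.
Qed.

Theorem theorem2p11 (R : realType) (G : topologicalGroupType)
  (G_hausdorff : hausdorff_space G)
  (G_locally_compact : locally_compact [set: G]%classic)
  (G_not_compact : ~ compact [set: G]%classic)
  (G_not_discrete : ~ (forall A : set G, open A)) :
  ~ F_space R (Gluc R G) /\ ~ F_space R (Gstar R G).
Proof.
have [C C1 [Cc _]] := G_locally_compact 1%g I.
have {}C1 : nbhs 1%g C.
  have {}C1 : \forall x \near nbhs 1%g, setT x -> C x by exact: C1.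
  by apply: filterS C1 => x; exact.
have [N [Nsn N1 NC Nsmall]] :=
  exists_group_seminorm R G_hausdorff G_not_discrete C1.
have [t tN] := exists_separated_sequence Nsn Cc NC G_not_compact.
have [U [UU Uoo]] := ultraFilterLemma (eventually_filter : ProperFilter \oo).
pose p := @orbit_limit R G U UU t.
have pcont : continuous p by exact: orbit_limit_continuous.
have r0 : (0 : R) < 2^-1 by rewrite invr_gt0.
have pstar g : p g \in ~` range (@Gluc_of R G).
  by rewrite inE; exact: (orbit_limit_notin_range Uoo Nsn N1 r0 tN).
pose D : LUC R G := dist_to_family_LUC Nsn N1 1%g t.
pose Dhat (chi : Gluc R G) := complex.Re (set_val chi D).
have Dcont : continuous Dhat.
  move=> chi; apply: (@continuous_comp _ _ _
    (fun chi : Gluc R G => set_val chi D) (fun z : R[i] => complex.Re z)).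
    exact: Gluc_eval_continuous.
  exact: Re_continuous.
(* The sequence is 1/2-separated, so [D] recovers [N] only below 1/4. *)
have Dp g : N g < 2^-1 / 2 -> Dhat (p g) = N g.
  move=> Ng; rewrite /Dhat (_ : set_val (p g) D = (N g)%:C)//.
  apply: orbit_limitE; apply: cvg_near_cst; apply: nearW => n /=.
  by rewrite (dist_to_separated_family n Nsn tN Ng).
have r1 : (0 : R) < 2^-1 / 2 by rewrite divr_gt0.
have NC' x : N x < 2^-1 / 2 -> C x by move=> Nx; apply: NC; lra.
split; first exact: (not_F_space Nsn Cc r1 NC' Nsmall pcont Dcont).
pose ps (g : G) : Gstar R G := exist _ (p g) (pstar g).
apply: (not_F_space (p := ps) (D := Dhat \o set_val) Nsn Cc r1 NC' Nsmall) => //.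
  by apply: continuous_comp_initial.
move=> chi; apply: (@continuous_comp (Gstar R G) (Gluc R G) R set_val Dhat).
  exact: (@initial_continuous (Gstar R G) (Gluc R G) set_val).
exact: Dcont.
Qed.
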